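(* Let $p_i,p_j,p_k\in\mathcal{P}$ be pivots, with domain radii $r_i,r_j\ge 0$ associated with $p_i,p_j$ respectively. Consider exemplars $x_i\in\mathcal{D}(p_i,r_i)$ and $x_j\in\mathcal{D}(p_j,r_j)$. If $$d(p_k,p_i)<d(p_i,p_j)-(2r_i+r_j)\quad\text{and}\quad d(p_k,p_j)<d(p_i,p_j)-(r_i+2r_j),$$ then $$\max\bigl(d(p_k,x_i),d(p_k,x_j)\bigr)<d(x_i,x_j).$$
   Context: $(\mathcal{X},d)$ is a metric space, $\mathcal{S}\subset\mathcal{X}$ is a finite dataset whose elements are called exemplars, and $\mathcal{P}\subset\mathcal{S}$ is a finite set of pivots. Each pivot $p_i$ has a radius $r_i\ge 0$, and its pivot domain is $\mathcal{D}(p_i,r_i)=\{x\in\mathcal{S}\mid d(x,p_i)\le r_i\}$. *)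

(* Defs.v *)
From mathcomp Require Import all_boot all_order all_algebra finmap.
From mathcomp Require Import all_classical reals topology.

Set Implicit Arguments.
Unset Strict Implicit.
Unset Printing Implicit Defensive.

Import Order.TTheory GRing.Theory Num.Theory.

Local Open Scope fset_scope.
Local Open Scope ring_scope.

(* The domain consists of points of the dataset [S] only: it is not the closed
   ball of radius [r] around [p] in the whole space [X]. *)
Definition pivot_domain (R : realType) (X : metricType R)
    (S : {fset X}) (p : X) (r : R) : {fset X} :=
  [fset x in S | mdist x p <= r].

(* Main.v *)
Require Import Defs.
From mathcomp Require Import all_boot all_order all_algebra finmap.
From mathcomp Require Import all_classical reals topology.
From mathcomp Require Import lra.

Import Order.TTheory GRing.Theory Num.Theory.

Local Open Scope fset_scope.
Local Open Scope ring_scope.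

(** Both distances are separated from [mdist xi xj] by the threshold [mdist pi pj - (ri + rj)].
    Going from [pi] to [pj] through [xi] and [xj] shows that [mdist xi xj] is at least this
    threshold. Going from [pk] to [xi] through [pi] costs at most [ri] more than [mdist pk pi],
    which [hki] keeps strictly below it; [hkj] does the same for [xj]. *)

Theorem theorem1 (R : realType) (X : metricType R) (S P : {fset X})
    (PS : (P `<=` S)%fset)
    (pi pj pk : X) (pi_P : pi \in P) (pj_P : pj \in P) (pk_P : pk \in P)
    (ri rj : R) (ri_ge0 : 0 <= ri) (rj_ge0 : 0 <= rj)
    (xi xj : X)
    (xi_D : xi \in pivot_domain S pi ri) (xj_D : xj \in pivot_domain S pj rj)
    (hki : mdist pk pi < mdist pi pj - (2 * ri + rj))
    (hkj : mdist pk pj < mdist pi pj - (ri + 2 * rj)) :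
  Num.max (mdist pk xi) (mdist pk xj) < mdist xi xj.
Proof.
have mem_domain S' p r x : x \in pivot_domain S' p r -> mdist x p <= r.
  by rewrite !inE => /andP[].
move: xi_D xj_D => /mem_domain xi_r /mem_domain xj_r.
have pij := metric_triangle pi xi pj.
have xij := metric_triangle xi xj pj.
have pkxi := metric_triangle pk pi xi.
have pkxj := metric_triangle pk pj xj.
(* Orient distances as in [xi_r] and [xj_r], so that [lra] sees the same atoms. *)
rewrite (metric_sym pi xi) in pij pkxi.
rewrite (metric_sym pj xj) in pkxj.
by rewrite gt_max; apply/andP; split; lra.
Qed.
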